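(* Let $\widetilde F:M^n\to\mathbb R^{n+m}$ be a properly immersed self-shrinker and let $f:M^n\to\mathbb R$ be a twice differentiable function such that $$f(x)\le C(1+|\widetilde F(x)|^{\alpha})\quad\text{for all }x\in M,$$ for some $C>0$ and $\alpha\in[0,1)$. Then there exists a sequence $\{x_i\}$ in $M$ such that $$f(x_i)\to\sup_M f,\qquad |\nabla f|(x_i)\to 0,\qquad \limsup_{i\to\infty}\mathcal L f(x_i)\le 0.$$
   Context: A self-shrinker is an immersion $\widetilde F:M^n\to\mathbb R^{n+m}$ of an $n$-dimensional manifold satisfying $\vec H=-\frac12\widetilde F^{\perp}$, where $\vec H$ is the mean curvature vector of $\widetilde F$ (the trace, with respect to the induced metric, of the second fundamental form $A(X,Y)=(\overline\nabla_XY)^\perp$, with $\overline\nabla$ the flat connection of $\mathbb R^{n+m}$) and $\widetilde F^\perp$, $\widetilde F^\top$ are the normal and tangential components of the position vector $\widetilde F$. It is properly immersed if $\widetilde F$ is a proper map (preimages of compact sets are compact). The operator $\mathcal L$ is defined by $$\mathcal L f=\Delta f-\tfrac12\langle\nabla f,\widetilde F^{\top}\rangle,$$ where $\nabla$ and $\Delta$ are the gradient and Laplace operator ($\operatorname{div}\nabla$) of the metric on $M$ induced by $\widetilde F$. The supremum $\sup_M f$ is allowed to be $+\infty$. *)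

(* Defs.v *)
From HB Require Import structures.
From mathcomp Require Import all_boot all_order all_algebra.
From mathcomp Require Import all_classical all_reals all_analysis.

Set Implicit Arguments.
Unset Strict Implicit.
Unset Printing Implicit Defensive.

Import Order.TTheory GRing.Theory Num.Theory.
Import numFieldNormedType.Exports.

Local Open Scope classical_set_scope.
Local Open Scope ring_scope.

(* The norm `|v| of the library on 'rV[R]_n is the sup norm; enorm is the
   Euclidean one. *)
Definition dot {R : realType} {n : nat} (v w : 'rV[R]_n) : R :=
  \sum_(i < n) v 0 i * w 0 i.

Definition enorm {R : realType} {n : nat} (v : 'rV[R]_n) : R :=
  Num.sqrt (dot v v).

Definition partial {R : realType} {n : nat} {W : normedModType R} (i : 'I_n)
    (u : 'rV[R]_n -> W) : 'rV[R]_n -> W :=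
  fun y => 'D_(delta_mx 0 i) u y.

(* Class C^k on U; U is always an open set below. *)
Fixpoint Ck_on {R : realType} {n : nat} {W : normedModType R} (k : nat)
    (U : set 'rV[R]_n) (u : 'rV[R]_n -> W) : Prop :=
  if k is k'.+1 then
    (forall y, U y -> differentiable u y) /\
    (forall i : 'I_n, Ck_on k' U (partial i u))
  else forall y, U y -> {for y, continuous u}.

Definition smooth_on {R : realType} {n : nat} {W : normedModType R}
    (U : set 'rV[R]_n) (u : 'rV[R]_n -> W) : Prop :=
  forall k, Ck_on k U u.

(* Twice Frechet differentiable; the second derivatives need not be
   continuous. *)
Definition twice_differentiable_on {R : realType} {n : nat}
    (U : set 'rV[R]_n) (h : 'rV[R]_n -> R) : Prop :=
  forall y, U y ->
    differentiable h y /\ (forall i : 'I_n, differentiable (partial i h) y).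

(* chart_map is a homeomorphism from chart_dom onto its open image, with
   inverse chart_inv; both functions are irrelevant off these sets. *)
Record chart (R : realType) (n : nat) (M : topologicalType) := Chart {
  chart_dom : set M;
  chart_map : M -> 'rV[R]_n;
  chart_inv : 'rV[R]_n -> M;
  chart_dom_open : open chart_dom;
  chart_img_open : open (chart_map @` chart_dom);
  chartK : forall x, chart_dom x -> chart_inv (chart_map x) = x;
  chart_map_continuous :
    forall x, chart_dom x -> {for x, continuous chart_map};
  chart_inv_continuous :
    forall y, (chart_map @` chart_dom) y -> {for y, continuous chart_inv}
}.

Definition chart_img {R : realType} {n : nat} {M : topologicalType}
    (c : chart R n M) : set 'rV[R]_n :=
  chart_map c @` chart_dom c.

(* Smooth manifold of dimension n without boundary; the atlas is not required
   to be maximal. *)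
Record manifold (R : realType) (n : nat) := Manifold {
  carrier :> topologicalType;
  manifold_hausdorff : hausdorff_space carrier;
  manifold_second_countable : @second_countable carrier;
  atlas : set (chart R n carrier);
  atlas_cover : forall x : carrier, exists2 c, atlas c & chart_dom c x;
  atlas_smooth : forall c d, atlas c -> atlas d ->
    smooth_on (chart_map c @` (chart_dom c `&` chart_dom d))
              (chart_map d \o chart_inv c)
}.

Arguments atlas {R n} _ _.

(* An arbitrary chart of the atlas around x. The pointwise quantities at x
   defined with it below do not depend on which chart is chosen. *)
Definition chart_at {R : realType} {n : nat} (M : manifold R n) (x : M) :
    chart R n M :=
  projT1 (cid2 (atlas_cover x)).

Definition coord_at {R : realType} {n : nat} {M : manifold R n} (x : M) :
    'rV[R]_n :=
  chart_map (chart_at x) x.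

Definition local_expr {R : realType} {n : nat} {M : manifold R n} {T : Type}
    (h : M -> T) (x : M) : 'rV[R]_n -> T :=
  h \o chart_inv (chart_at x).

(* Riemannian geometry in coordinates: G y is the matrix (g_ij) at y, and a
   vector field X has components X^i = X y 0 i. *)

Definition christoffel {R : realType} {n : nat} (G : 'rV[R]_n -> 'M[R]_n)
    (k i j : 'I_n) (y : 'rV[R]_n) : R :=
  2^-1 * \sum_(l < n) invmx (G y) k l *
    (partial i (fun z => G z j l) y + partial j (fun z => G z i l) y
     - partial l (fun z => G z i j) y).

Definition gradient {R : realType} {n : nat} (G : 'rV[R]_n -> 'M[R]_n)
    (h : 'rV[R]_n -> R) (y : 'rV[R]_n) : 'rV[R]_n :=
  \row_(i < n) \sum_(j < n) invmx (G y) i j * partial j h y.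

Definition metric_norm {R : realType} {n : nat} (g : 'M[R]_n)
    (X : 'rV[R]_n) : R :=
  Num.sqrt (\sum_(i < n) \sum_(j < n) g i j * X 0 i * X 0 j).

(* The trace of the covariant derivative of X for the Levi-Civita connection. *)
Definition divergence {R : realType} {n : nat} (G : 'rV[R]_n -> 'M[R]_n)
    (X : 'rV[R]_n -> 'rV[R]_n) (y : 'rV[R]_n) : R :=
  \sum_(i < n) (partial i (fun z => X z 0 i) y
                + \sum_(k < n) christoffel G i i k y * X y 0 k).

Definition laplacian {R : realType} {n : nat} (G : 'rV[R]_n -> 'M[R]_n)
    (h : 'rV[R]_n -> R) : 'rV[R]_n -> R :=
  divergence G (gradient G h).

(* Extrinsic geometry of a parametrized immersion u : R^n -> R^p. *)

Definition induced_metric {R : realType} {n p : nat}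
    (u : 'rV[R]_n -> 'rV[R]_p) (y : 'rV[R]_n) : 'M[R]_n :=
  \matrix_(i < n, j < n) dot (partial i u y) (partial j u y).

(* The row space of 'J u y is the tangent space (the range of 'd u y), and that
   of kermx ('J u y)^T is its orthogonal complement. *)
Definition tangent_part {R : realType} {n p : nat}
    (u : 'rV[R]_n -> 'rV[R]_p) (y : 'rV[R]_n) (v : 'rV[R]_p) : 'rV[R]_p :=
  v *m proj_mx <<'J u y>>%MS (kermx ('J u y)^T).

Definition normal_part {R : realType} {n p : nat}
    (u : 'rV[R]_n -> 'rV[R]_p) (y : 'rV[R]_n) (v : 'rV[R]_p) : 'rV[R]_p :=
  v - tangent_part u y v.

(* A(X, Y) for X, Y the coordinate fields partial i u, partial j u: the flat
   derivative of Y along X is then partial i (partial j u). *)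
Definition second_fundamental_form {R : realType} {n p : nat}
    (u : 'rV[R]_n -> 'rV[R]_p) (y : 'rV[R]_n) (i j : 'I_n) : 'rV[R]_p :=
  normal_part u y (partial i (partial j u) y).

Definition mean_curvature {R : realType} {n p : nat}
    (u : 'rV[R]_n -> 'rV[R]_p) (y : 'rV[R]_n) : 'rV[R]_p :=
  \sum_(i < n) \sum_(j < n)
    invmx (induced_metric u y) i j *: second_fundamental_form u y i j.

(* 'd u y (gradient _ h y) is the gradient as a tangent vector in R^p. *)
Definition drift_laplacian {R : realType} {n p : nat}
    (u : 'rV[R]_n -> 'rV[R]_p) (h : 'rV[R]_n -> R) (y : 'rV[R]_n) : R :=
  laplacian (induced_metric u) h y
  - 2^-1 * dot ('d u y (gradient (induced_metric u) h y))
               (tangent_part u y (u y)).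

(* The same notions on a manifold. *)

Definition immersion {R : realType} {n p : nat} (M : manifold R n)
    (F : M -> 'rV[R]_p) : Prop :=
  forall c, atlas M c ->
    smooth_on (chart_img c) (F \o chart_inv c) /\
    (forall y, chart_img c y -> injective ('d (F \o chart_inv c) y)).

Definition twice_differentiable {R : realType} {n : nat} (M : manifold R n)
    (f : M -> R) : Prop :=
  forall c, atlas M c ->
    twice_differentiable_on (chart_img c) (f \o chart_inv c).

Definition self_shrinker {R : realType} {n m : nat} (M : manifold R n)
    (F : M -> 'rV[R]_(n + m)) : Prop :=
  immersion F /\
  forall x : M,
    mean_curvature (local_expr F x) (coord_at x)
    = - 2^-1 *: normal_part (local_expr F x) (coord_at x) (F x).

Definition proper_map {X Y : topologicalType} (F : X -> Y) : Prop :=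
  forall K : set Y, compact K -> compact (F @^-1` K).

Definition norm_grad {R : realType} {n p : nat} (M : manifold R n)
    (F : M -> 'rV[R]_p) (f : M -> R) (x : M) : R :=
  let G := induced_metric (local_expr F x) in
  metric_norm (G (coord_at x)) (gradient G (local_expr f x) (coord_at x)).

Definition calL {R : realType} {n p : nat} (M : manifold R n)
    (F : M -> 'rV[R]_p) (f : M -> R) (x : M) : R :=
  drift_laplacian (local_expr F x) (local_expr f x) (coord_at x).

(* Main.v *)
Require Import Defs.
From HB Require Import structures.
From mathcomp Require Import all_boot all_order all_algebra.
From mathcomp Require Import all_classical all_reals all_analysis.
From mathcomp Require Import ring lra.

Set Implicit Arguments.
Unset Strict Implicit.
Unset Printing Implicit Defensive.

Import Order.TTheory GRing.Theory Num.Theory.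
Import numFieldNormedType.Exports.

Local Open Scope classical_set_scope.
Local Open Scope ring_scope.

(** Let [q = |F|^2]. On a self-shrinker [L q = 2 n - q]: the trace of the
    coordinate Hessian of [q] contributes [2 n + 2 <W, F>], where [W] is the
    metric trace of the flat second derivatives of [F], while the first-order
    terms of the Laplacian and the drift together subtract [2 <W + F/2, T F>]
    with [T] the tangential projection. The shrinker equation says precisely that
    [W + F/2] is tangent, so this last term is [2 <W, F> + q].

    For [e > 0] consider [f - e q]. As [f] grows at most like [|F|^alpha] with
    [alpha < 2] and [F] is proper, it attains its maximum at some [x_e]
    ([penalized_max]). In a chart around [x_e] the first derivatives of [f] are
    those of [e q], whence [grad f = 2 e T F], and the Hessian of [f - e q] is
    negative semidefinite. As the inverse metric is a Gram matrix [B B^T], its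
    contraction with that Hessian is a sum of second directional derivatives at
    a maximum, hence nonpositive. Therefore
      [|grad f| (x_e) <= 2 e |F (x_e)|] ([metric_norm_gradient_at_max]) and
      [L f (x_e) <= e L q (x_e) <= 2 n e] ([drift_laplacian_at_max]).
    The coordinate formula for [L] behind these bounds is [drift_laplacianE]; it
    rests on the symmetry of the second derivatives of [F] ([mixed_deriveC]).

    Let [e] tend to [0]. For a fixed [y], [f (x_e) >= f y - e q y], so [f (x_e)]
    tends to the supremum of [f]. Comparing [x_e] with a fixed point gives
    [e q (x_e) <= C (1 + |F (x_e)|^alpha) + D]. Multiplied by [e], this reads
    [t^2 <= e (C + D) + C e^(1 - alpha) t^alpha] for [t = e |F (x_e)|], and
    [alpha < 1] is what makes [t] tend to [0] ([scaled_norm_small]). *)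

(** * Second derivatives along lines *)

Section lines.
Context {R : realType} {V : normedModType R}.
Implicit Types (h : V -> R) (y v : V).

Lemma is_derive_line h y v t d : is_derive (y + t *: v) v h d ->
  is_derive t (1 : R) (fun s : R => h (y + s *: v)) d.
Proof.
move=> [hd <-].
have E : (fun k : R => k^-1 *: (((fun s : R => h (y + s *: v)) \o shift t) (k *: 1) -
            h (y + t *: v))) =
         (fun k : R => k^-1 *: ((h \o shift (y + t *: v)) (k *: v) - h (y + t *: v))).
  apply/funext => k /=; congr (_ *: (h _ - _)).
  by rewrite [k *: 1]mulr1 scalerDl addrCA.
by apply: DeriveDef; rewrite /derivable /derive E.
Qed.

Lemma near_line (P : set V) y v t : (\forall z \near y + t *: v, P z) ->
  \forall s \near t, P (y + s *: v).
Proof.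
move=> yP; have : (fun s : R => y + s *: v) @ t --> y + t *: v.
  by apply: cvgD; [exact: cvg_cst|apply: cvgZr_tmp; exact: cvg_id].
by move=> /(_ _ yP).
Qed.

(** Were the second derivative positive, the first derivative would be positive
    just after the maximum point, and the mean value theorem would give larger
    values there. *)
Lemma second_derive_at_max h y v s :
  (\forall z \near y, derivable h z v) -> is_derive y v ('D_v h) s ->
  (\forall z \near y, h z <= h y) -> 'D_v h y = 0 /\ s <= 0.
Proof.
move=> hd ds hmax.
set p := fun t : R => h (y + t *: v).
set p' := fun t : R => 'D_v h (y + t *: v).
have y0 : y + 0 *: v = y by rewrite scale0r addr0.
have [e /= e0 pe] : exists2 e : R, 0 < e & forall t, `|t| < e ->
    is_derive t (1 : R) p (p' t) /\ p t <= p 0.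
  have : \forall t \near (0 : R), is_derive t (1 : R) p (p' t) /\ p t <= p 0.
    have hd0 : \forall t \near (0 : R), derivable h (y + t *: v) v.
      by apply: (near_line (P := fun z => derivable h z v)); rewrite y0.
    have hm0 : \forall t \near (0 : R), h (y + t *: v) <= h y.
      by apply: (near_line (P := fun z => h z <= h y)); rewrite y0.
    near=> t; split; last by rewrite {2}/p y0; near: t.
    by apply: is_derive_line; apply: derivableP; near: t.
  move=> /nbhs_ballP[e /= e0 H]; exists e => // t te; apply: H.
  by rewrite /ball /= sub0r normrN.
have p'0 : p' 0 = 0.
  have [|d0 _] := pe 0; first by rewrite normr0.
  have : is_derive (0 : R) (1 : R) p 0.
    apply: (@derive1_at_max _ p (- e) e).
    - by rewrite ge0_cp// ltW.
    - move=> t; rewrite in_itv /= -ltr_norml => /pe[tp _].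
      exact: ex_derive.
    - by rewrite in_itv /= oppr_lt0 e0.
    - by move=> t; rewrite in_itv /= -ltr_norml => /pe[].
  by move=> d0'; rewrite -(@derive_val _ _ _ _ _ _ _ d0) derive_val.
split; first by rewrite -p'0 /p' y0.
rewrite leNgt; apply/negP => s0.
have dp' : is_derive (0 : R) (1 : R) p' s by
  rewrite -[y]y0 in ds; exact: is_derive_line.
have : (fun k : R => k^-1 *: ((p' \o shift 0) (k *: 1) - p' 0)) @ 0^' --> s.
  by have [+ <-] := dp'.
move=> /cvgr_gt /(_ _ s0).
rewrite near_withinE => /nbhs_ballP[r /= r0 H].
pose t := (Num.min e r) / 2.
have m0 : 0 < Num.min e r by rewrite lt_min e0.
have t0 : 0 < t by rewrite divr_gt0.
have tm : t < Num.min e r by rewrite ltr_pdivrMr// ltr_pMr// ltr1n.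
have te : t < e by rewrite (lt_le_trans tm)// ge_min lexx.
have tr : t < r by rewrite (lt_le_trans tm)// ge_min lexx orbT.
have dp x : x \in `]0, t[ -> is_derive x (1 : R) p (p' x).
  rewrite in_itv /= => /andP[x0 xt].
  by have [|//] := pe x; rewrite gtr0_norm// (lt_trans xt).
have [] := @MVT _ p p' 0 t t0 dp.
  apply: derivable_within_continuous => x; rewrite in_itv /= => /andP[x0 xt].
  have [|dx _] := pe x; first by rewrite ger0_norm// (le_lt_trans xt).
  exact: ex_derive.
move=> c; rewrite in_itv /= => /andP[c0 ct].
rewrite subr0 => E.
have [|_] := pe t; first by rewrite gtr0_norm.
rewrite -subr_le0 E; apply/negP; rewrite -ltNge mulr_gt0//.
have := H c; rewrite /ball /= sub0r normrN gtr0_norm// (lt_trans ct)//.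
rewrite gt_eqF// => /(_ isT isT).
by rewrite [c *: 1]mulr1 addr0 p'0 subr0 [_ *: _]mulrC pmulr_lgt0// invr_gt0.
Unshelve. all: by end_near. Qed.

End lines.

(** * Symmetry of mixed derivatives *)

Section schwarz.
Context {R : realType} {V : normedModType R}.
Implicit Types (h : V -> R) (y a b : V).

Definition rectangle h y a b : R := h (y + a + b) - h (y + a) - h (y + b) + h y.

Lemma rectangleC h y a b : rectangle h y a b = rectangle h y b a.
Proof. by rewrite /rectangle [y + a + b]addrAC; ring. Qed.

(** By the mean value theorem in the direction [a], the rectangle difference is
    [t] times an increment of the derivative [g] along [t b]; differentiability
    of [g] at the single point [y] gives that increment up to [o(t)]. *)
Lemma rectangle_approx h g y a b (e : R) : 0 < e ->
  (\forall z \near y, is_derive z a h (g z)) -> differentiable g y ->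
  exists2 d : R, 0 < d & forall t, 0 < t -> t < d ->
    `|rectangle h y (t *: b) (t *: a) - t ^+ 2 * 'D_b g y| <= e * t ^+ 2.
Proof.
move=> e0 /nbhs_ballP[r1 /= r10 hd] dg.
(* All the points involved lie within [t N] of [y]; the summand [1] keeps [N]
   positive. *)
pose N := `|a| + `|b| + 1.
have N0 : 0 < N by rewrite /N ltr_wpDl// addr_ge0.
have eN0 : 0 < e / (2 * N) by rewrite divr_gt0// mulr_gt0.
have [r2 r20 gd] : exists2 r : R, 0 < r & forall w : V, `|w| < r ->
    `|g (y + w) - g y - 'd g y w| <= e / (2 * N) * `|w|.
  have /eqaddoP/(_ _ eN0) := diff_locally dg.
  move=> /nbhs_ballP[r /= r0 H]; exists r => // w wr.
  have /H /= : ball (0 : V) r w by rewrite -ball_normE /= sub0r normrN.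
  by rewrite !fctE opprD addrA [w + y]addrC.
pose r := Num.min r1 r2.
have r0 : 0 < r by rewrite lt_min r10.
exists (r / N); first by rewrite divr_gt0.
move=> t t0; rewrite ltr_pdivlMr// => tr.
have small (u s : R) : 0 <= u <= t -> 0 <= s <= t ->
    `|u *: b + s *: a| < r /\ `|u *: b + s *: a| <= t * N.
  move=> /andP[u0 ut] /andP[s0 st].
  suff : `|u *: b + s *: a| <= t * N by move=> H; split => //; exact: le_lt_trans tr.
  rewrite (le_trans (ler_normD _ _))// !normrZ !ger0_norm//.
  rewrite /N !mulrDr mulr1 addrC ler_wpDr ?(ltW t0)//.
  by rewrite lerD// ler_wpM2r.
pose p s := h (y + t *: b + s *: a) - h (y + s *: a).
pose p' s := g (y + t *: b + s *: a) - g (y + s *: a).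
have dp s : 0 <= s <= t -> is_derive s (1 : R) p (p' s).
  move=> st.
  have hz (u : R) : 0 <= u <= t ->
      is_derive (y + u *: b + s *: a) a h (g (y + u *: b + s *: a)).
    move=> ut; apply: hd.
    rewrite -ball_normE /= opprD opprD !addrA subrr sub0r -opprD normrN.
    by have [+ _] := small _ _ ut st; rewrite lt_min => /andP[].
  have h1 := hz t; have h2 := hz 0; rewrite scale0r addr0 in h2.
  apply: is_deriveB; apply: is_derive_line.
    by apply: h1; rewrite lexx ltW.
  by apply: h2; rewrite lexx ltW.
have [||c] := @MVT _ p p' 0 t t0.
- by move=> x /[!in_itv] /= /andP[x0 xt]; apply: dp; rewrite !ltW.
- apply: derivable_within_continuous => x; rewrite in_itv /= => /dp[dx _].
  exact: dx.
rewrite in_itv /= => /andP[c0 ct]; rewrite subr0 => E.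
have -> : rectangle h y (t *: b) (t *: a) = p' c * t.
  by rewrite -E /p /rectangle scale0r !addr0; ring.
have gE : 'D_b g y = 'd g y b by rewrite deriveE.
have cle : 0 <= c <= t by rewrite !ltW.
have tle : 0 <= t <= t by rewrite lexx ltW.
have zle : 0 <= (0 : R) <= t by rewrite lexx ltW.
have [A1 A2] := small _ _ tle cle.
have [B1 B2] := small _ _ zle cle.
have := gd _ (lt_le_trans A1 _); rewrite ge_min lexx orbT => /(_ isT).
have := gd _ (lt_le_trans B1 _); rewrite ge_min lexx orbT => /(_ isT).
move: B2; rewrite !scale0r !add0r !addrA => B2.
have -> : 'd g y (c *: a) = c * 'd g y a by rewrite linearZ.
have -> : 'd g y (t *: b + c *: a) = t * 'D_b g y + c * 'd g y a.
  by rewrite linearD !linearZ gE.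
set X := _ - _ - _ => HX; set Y := _ - _ - _ => HY.
have -> : p' c * t - t ^+ 2 * 'D_b g y = t * (Y - X).
  by rewrite /X /Y /p'; ring.
have -> : e * t ^+ 2 = t * (e / (2 * N) * (t * N) + e / (2 * N) * (t * N)).
  by field; rewrite gt_eqF.
rewrite normrM gtr0_norm// ler_wpM2l ?(ltW t0)//.
rewrite (le_trans (ler_normB _ _))// lerD//.
  by rewrite (le_trans HY)// ler_wpM2l// ltW.
by rewrite (le_trans HX)// ler_wpM2l// ltW.
Qed.

(** Schwarz's theorem: both mixed derivatives are the limit of the rectangle
    difference divided by [t ^+ 2]. *)
Lemma mixed_deriveC h ga gb y a b :
  (\forall z \near y, is_derive z a h (ga z)) ->
  (\forall z \near y, is_derive z b h (gb z)) ->
  differentiable ga y -> differentiable gb y ->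
  'D_b ga y = 'D_a gb y.
Proof.
move=> ha hb da db; apply/eqP; rewrite -subr_eq0 -normr_le0.
apply/ler_addgt0Pl => e e0; rewrite addr0.
have e2 : 0 < e / 2 by rewrite divr_gt0.
have [r r0 Hr] := rectangle_approx b e2 ha da.
have [s s0 Hs] := rectangle_approx a e2 hb db.
pose t := Num.min r s / 2.
have m0 : 0 < Num.min r s by rewrite lt_min r0.
have t0 : 0 < t by rewrite divr_gt0.
have tm : t < Num.min r s by rewrite ltr_pdivrMr// ltr_pMr// ltr1n.
have := Hr t t0; rewrite (lt_le_trans tm) ?ge_min ?lexx// => /(_ isT).
have := Hs t t0; rewrite (lt_le_trans tm) ?ge_min ?lexx ?orbT// => /(_ isT).
rewrite rectangleC => H1 H2.
have t20 : 0 < t ^+ 2 by rewrite exprn_gt0.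
rewrite -(ler_pM2l t20) -{1}(gtr0_norm t20) -normrM.
move: H1 H2; set A := rectangle _ _ _ _ => H1 H2.
have -> : t ^+ 2 * ('D_b ga y - 'D_a gb y) =
  (A - t ^+ 2 * 'D_a gb y) - (A - t ^+ 2 * 'D_b ga y) by ring.
rewrite (le_trans (ler_normB _ _))// (le_trans (lerD H1 H2))//.
by rewrite -mulrDl -splitr mulrC.
Qed.

End schwarz.

(** * Euclidean product and Gram matrices *)

Section dot.
Context {R : realType}.

Lemma dotE n (v w : 'rV[R]_n) : dot v w = (v *m w^T) 0 0.
Proof. by rewrite mxE; apply: eq_bigr => i _; rewrite mxE. Qed.

Lemma dotC n (v w : 'rV[R]_n) : dot v w = dot w v.
Proof. by apply: eq_bigr => i _; rewrite mulrC. Qed.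

Lemma dotDl n (v w x : 'rV[R]_n) : dot (v + w) x = dot v x + dot w x.
Proof. by rewrite !dotE mulmxDl mxE. Qed.

Lemma dotZl n a (v x : 'rV[R]_n) : dot (a *: v) x = a * dot v x.
Proof. by rewrite !dotE -scalemxAl mxE. Qed.

Lemma dot_suml n (I : finType) (v : I -> 'rV[R]_n) x :
  dot (\sum_i v i) x = \sum_i dot (v i) x.
Proof. by rewrite dotE mulmx_suml summxE; apply: eq_bigr => i _; rewrite dotE. Qed.

Lemma dot_ge0 n (v : 'rV[R]_n) : 0 <= dot v v.
Proof. by apply: sumr_ge0 => i _; rewrite -expr2 sqr_ge0. Qed.

Lemma dot_eq0 n (v : 'rV[R]_n) : dot v v = 0 -> v = 0.
Proof.
move=> /eqP; rewrite psumr_eq0 => [|i _]; last by rewrite -expr2 sqr_ge0.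
move=> /allP v0; apply/rowP => i; rewrite mxE.
by have := v0 i (mem_index_enum _); rewrite mulf_eq0 orbb => /eqP.
Qed.

End dot.

Section gram.
Context {R : realType} {n p : nat}.
Variable J : 'M[R]_(n, p).
Hypothesis J_inj : forall v : 'rV_n, v *m J = 0 -> v = 0.
Let g := J *m J^T.

Lemma gram_sym : g^T = g.
Proof. by rewrite /g trmx_mul trmxK. Qed.

Lemma gram_inj (v : 'rV_n) : v *m g = 0 -> v = 0.
Proof.
move=> vg; apply/J_inj/dot_eq0.
by rewrite dotE trmx_mul mulmxA -(mulmxA v) vg mul0mx mxE.
Qed.

Lemma gram_unit : g \in unitmx.
Proof.
rewrite -row_free_unit -kermx_eq0; apply/eqP/row_matrixP => i; rewrite row0.
by apply: gram_inj; rewrite -row_mul mulmx_ker row0.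
Qed.

Lemma invmx_gram_sym : (invmx g)^T = invmx g.
Proof. by rewrite trmx_inv gram_sym. Qed.

(** The orthogonal projection onto the row space of [J] has the normal-equation
    formula: both sides fix that space and kill its orthogonal complement. *)
Lemma proj_gramE (v : 'rV_p) :
  v *m proj_mx <<J>>%MS (kermx J^T) = v *m J^T *m invmx g *m J.
Proof.
have dx : (<<J>> :&: kermx J^T = 0)%MS.
  apply/eqP; rewrite -submx0; apply/row_subP => i.
  have := row_sub i (<<J>> :&: kermx J^T)%MS; set w := row i _.
  rewrite sub_capmx genmxE => /andP[/submxP[x ->] /sub_kermxP].
  by rewrite -mulmxA => /gram_inj ->; rewrite mul0mx sub0mx.
set q := _ *m J.
rewrite -[v in LHS](subrK q) mulmxDl [in X in _ + X]proj_mx_id//; last first.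
  by rewrite genmxE submxMl.
rewrite proj_mx_0 ?add0r//; apply/sub_kermxP.
by rewrite mulmxBl /q -!mulmxA mulVmx ?gram_unit// mulmx1 subrr.
Qed.

End gram.

(** * Derivatives of matrix-valued maps *)

Section matrix_calculus.
Context {R : realType} {V : normedModType R}.
Implicit Types (y v : V).

Lemma is_derive_diff (W : normedModType R) (h : V -> W) y v :
  differentiable h y -> is_derive y v h ('D_v h y).
Proof. by move=> /(diff_derivable (v := v)); exact: derivableP. Qed.

Lemma is_derive_mxP m n (A : V -> 'M[R]_(m, n)) D y v :
  is_derive y v A D <-> forall i j, is_derive y v (fun z => A z i j) (D i j).
Proof.
split=> [[Ad <-] i j|Ad].
  by rewrite derive_mx// mxE; apply: derivableP; apply/derivable_mxP: i j.
have Ad' : derivable A y v by apply/derivable_mxP => i j; exact: ex_derive.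
apply: DeriveDef => //; rewrite derive_mx//; apply/matrixP => i j; rewrite mxE.
exact: derive_val.
Qed.

Lemma is_derive_bigsum n (F : 'I_n -> V -> R) d y v :
  (forall i, is_derive y v (F i) (d i)) ->
  is_derive y v (fun z => \sum_(i < n) F i z) (\sum_(i < n) d i).
Proof.
move=> Fd; have -> : (fun z => \sum_(i < n) F i z) = \sum_(i < n) F i.
  by apply/funext => z; rewrite fct_sumE.
exact: is_derive_sum.
Qed.

Lemma is_derive_mul (f h : V -> R) df dh y v :
  is_derive y v f df -> is_derive y v h dh ->
  is_derive y v (fun z => f z * h z) (df * h y + f y * dh).
Proof.
move=> fd hd; have := is_deriveM fd hd.
by rewrite addrC /GRing.scale /= [h y * df]mulrC.
Qed.

Lemma is_derive_trmx m n (A : V -> 'M[R]_(m, n)) D y v :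
  is_derive y v A D -> is_derive y v (fun z => (A z)^T) D^T.
Proof.
move=> /is_derive_mxP Ad; apply/is_derive_mxP => i j; rewrite mxE.
by under eq_fun do rewrite mxE.
Qed.

Lemma is_derive_mulmx m n p (A : V -> 'M[R]_(m, n)) (B : V -> 'M[R]_(n, p))
    dA dB y v : is_derive y v A dA -> is_derive y v B dB ->
  is_derive y v (fun z => A z *m B z) (dA *m B y + A y *m dB).
Proof.
move=> /is_derive_mxP Ad /is_derive_mxP Bd; apply/is_derive_mxP => i j.
rewrite !mxE -big_split /=; under eq_fun do rewrite mxE.
by apply: is_derive_bigsum => k; exact: is_derive_mul.
Qed.

Lemma is_derive_dot n (a b : V -> 'rV[R]_n) da db y v :
  is_derive y v a da -> is_derive y v b db ->
  is_derive y v (fun z => dot (a z) (b z)) (dot da (b y) + dot (a y) db).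
Proof.
move=> ad bd; have /is_derive_mxP/(_ 0 0) :=
  is_derive_mulmx ad (is_derive_trmx bd).
by under eq_fun do rewrite -dotE; rewrite mxE -!dotE.
Qed.

Lemma derivable_bigsum (I : finType) (F : I -> V -> R) y v :
  (forall i, derivable (F i) y v) ->
  derivable (fun z => \sum_i F i z) y v.
Proof.
move=> Fd; elim: (index_enum I) => [|i r IH].
  by under eq_fun do rewrite big_nil; exact: derivable_cst.
by under eq_fun do rewrite big_cons; exact: derivableD.
Qed.

Lemma derivable_bigprod (I : finType) (F : I -> V -> R) y v :
  (forall i, derivable (F i) y v) ->
  derivable (fun z => \prod_i F i z) y v.
Proof.
move=> Fd; elim: (index_enum I) => [|i r IH].
  by under eq_fun do rewrite big_nil; exact: derivable_cst.
by under eq_fun do rewrite big_cons; exact: derivableM.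
Qed.

Lemma derivable_det n (A : V -> 'M[R]_n) y v :
  (forall i j, derivable (fun z => A z i j) y v) ->
  derivable (fun z => \det (A z)) y v.
Proof.
move=> Ad; apply: derivable_bigsum => s.
by apply: derivableM; [exact: derivable_cst|exact: derivable_bigprod].
Qed.

(** Cramer's rule makes the inverse derivable; its derivative then follows by
    differentiating [A^-1 A = 1]. *)
Lemma is_derive_invmx n (A : V -> 'M[R]_n) dA y v :
  (\forall z \near y, A z \in unitmx) -> is_derive y v A dA ->
  is_derive y v (fun z => invmx (A z)) (- (invmx (A y) *m dA *m invmx (A y))).
Proof.
move=> Au Ad; have Ay := nbhs_singleton Au.
have Aij i j : derivable (fun z => A z i j) y v.
  by apply/derivable_mxP: i j; exact: ex_derive.
have Id : derivable (fun z => invmx (A z)) y v.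
  apply/derivable_mxP => i j.
  apply: (@near_eq_derivable _ _ _ (fun z => (\det (A z))^-1 * cofactor (A z) j i)).
    near=> z; have Az : A z \in unitmx by near: z.
    by rewrite /invmx Az !mxE.
  apply: derivableM.
    apply: derivableV; first by move: Ay; rewrite unitmxE unitfE.
    exact: derivable_det.
  apply: (@derivableM _ _ (fun=> (-1) ^+ (j + i))
    (fun z => \det (row' j (col' i (A z))))).
    exact: derivable_cst.
  apply: derivable_det => k l.
  by under eq_fun do rewrite !mxE; exact: Aij.
have := is_derive_mulmx (derivableP Id) Ad.
set D := 'D_v _ y => dAI.
have : is_derive y v (fun z => invmx (A z) *m A z) 0.
  apply: near_eq_is_derive (is_derive_cst 1%:M y v).
  by near=> z; rewrite mulVmx//; near: z.
move=> [_ d0]; have := @derive_val _ _ _ _ _ _ _ dAI; rewrite d0.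
move=> /esym/eqP; rewrite addr_eq0 => /eqP DE.
have <- : D = - (invmx (A y) *m dA *m invmx (A y)).
  by rewrite -mulNmx -DE mulmxK.
exact: derivableP.
Unshelve. all: by end_near. Qed.

End matrix_calculus.

(** * Derivatives at a maximum in coordinates *)

Section maximum.
Context {R : realType} {n : nat}.
Implicit Types (h : 'rV[R]_n -> R) (y v : 'rV[R]_n).

Lemma differentiable_dot p (a b : 'rV[R]_n -> 'rV[R]_p) y :
  differentiable a y -> differentiable b y ->
  differentiable (fun z => dot (a z) (b z)) y.
Proof.
move=> da db; rewrite /dot.
have -> : (fun z => \sum_(k < p) a z 0 k * b z 0 k) =
    \sum_(k < p) (fun z => a z 0 k * b z 0 k).
  by apply/funext => z; rewrite fct_sumE.
apply: differentiable_sum => k; apply: differentiableM.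
  exact: (differentiable_comp da (differentiable_coord _ 0 k)).
exact: (differentiable_comp db (differentiable_coord _ 0 k)).
Qed.

Lemma derive_partials h y v : differentiable h y ->
  'D_v h y = \sum_i v 0 i * partial i h y.
Proof.
move=> hd; rewrite deriveE// {1}[v]row_sum_delta linear_sum.
by apply: eq_bigr => i _; rewrite linearZ /partial deriveE.
Qed.

(** The partial derivatives are passed as functions [dh] that agree with them
    near [y], so that formulas valid only near [y] can be differentiated. *)
Lemma hessian_at_max h (dh : 'I_n -> 'rV[R]_n -> R) y v :
  (\forall z \near y, differentiable h z) ->
  (forall j, \forall z \near y, partial j h z = dh j z) ->
  (forall j, differentiable (dh j) y) ->
  (\forall z \near y, h z <= h y) ->
  (forall j, dh j y = 0) /\
  \sum_i \sum_j v 0 i * v 0 j * partial i (dh j) y <= 0.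
Proof.
move=> hd hdh dhd hmax.
have D w : 'D_w h y = 0 /\ \sum_i \sum_j w 0 i * w 0 j * partial i (dh j) y <= 0.
  apply: (second_derive_at_max (v := w)) hmax.
    by apply: filterS hd => z /diff_derivable.
  have Dh : \forall z \near y, \sum_j w 0 j * dh j z = 'D_w h z.
    have hdh' : \forall z \near y, forall j, partial j h z = dh j z.
      exact: filter_forall hdh.
    apply: filterS2 hd hdh' => z hz hdz.
    by rewrite (derive_partials w hz); apply: eq_bigr => j _; rewrite hdz.
  apply: near_eq_is_derive Dh _; rewrite exchange_big /=.
  apply: is_derive_bigsum => j.
  have dj := is_derive_diff w (dhd j).
  have := is_derive_mul (is_derive_cst (w 0 j) y w) dj.
  rewrite mul0r add0r (derive_partials w (dhd j)) mulr_sumr.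
  set s := \sum_i _; set t := \sum_i _; suff -> : s = t by [].
  by apply: eq_bigr => i _; rewrite mulrA [w 0 j * _]mulrC.
split; last by have [] := D v.
move=> j; have [+ _] := D (delta_mx 0 j).
by have /nbhs_singleton := hdh j; rewrite /partial => ->.
Qed.

End maximum.

(** * The Laplacian of an immersion *)

(** The algebra behind the coordinate formula of the Laplacian, at one point:
    [J] is the Jacobian, [gi] the inverse metric, row [a] of [K i] the second
    derivative in the directions [i] and [a], and [T i] the derivative of the
    metric in the direction [i]. *)
Section trace_algebra.
Context {R : realType} {n p : nat}.
Variables (J : 'M[R]_(n, p)) (gi : 'M[R]_n) (K : 'I_n -> 'M[R]_(n, p)).
Hypothesis gi_sym : gi^T = gi.
Hypothesis K_sym : forall a b, row a (K b) = row b (K a).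
Let T i : 'M[R]_n := K i *m J^T + J *m (K i)^T.
Let S k := \tr (gi *m (J *m (K k)^T)).

Let giC a b : gi a b = gi b a.
Proof. by rewrite -{1}gi_sym mxE. Qed.

Let KC a b q : K a b q = K b a q.
Proof. by have /rowP/(_ q) := K_sym a b; rewrite !mxE. Qed.

Let TC i a b : T i a b = T i b a.
Proof.
suff E : (T i)^T = T i by rewrite -{1}E mxE.
by rewrite /T linearD /= !trmx_mul !trmxK addrC.
Qed.

(** The first and last terms of the Christoffel symbols cancel in the trace
    because [gi] and each [T i] are symmetric. *)
Lemma christoffel_trace k :
  \sum_i 2^-1 * (\sum_l gi i l * (T i k l + T k i l - T l i k)) = S k.
Proof.
rewrite -mulr_sumr.
under eq_bigr do under eq_bigr do rewrite addrAC mulrDr.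
under eq_bigr do rewrite big_split /=.
rewrite big_split /= [X in X + _](_ : _ = 0) ?add0r; last first.
  under eq_bigr do under eq_bigr do rewrite mulrBr.
  under eq_bigr do rewrite sumrB.
  rewrite sumrB [X in _ - X]exchange_big /=; apply/eqP; rewrite subr_eq0.
  by apply/eqP; do 2! apply: eq_bigr => ? _; rewrite giC TC.
have -> : \sum_i \sum_l gi i l * T k i l = \tr (gi *m T k).
  apply: eq_bigr => i _; rewrite [RHS]mxE; apply: eq_bigr => l _.
  by rewrite TC.
rewrite /T mulmxDr mxtraceD -[X in X + _]mxtrace_tr.
rewrite !trmx_mul trmxK gi_sym mxtrace_mulC.
by rewrite mulrC mulrDl -splitr.
Qed.

(** One of the two terms of the derivative of the inverse metric cancels against
    the trace of the Christoffel symbols; this is where the symmetry [K_sym] of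
    second derivatives enters. The other one gives, up to sign, the coordinates
    of the tangential part of the trace of the second derivatives. *)
Lemma laplacian_drift j :
  \sum_i (- (gi *m T i *m gi)) i j + \sum_k S k * gi k j =
  - ((\sum_i \sum_a gi i a *: row a (K i)) *m J^T *m gi) 0 j.
Proof.
have E1 : \sum_i (gi *m (K i *m J^T) *m gi) i j =
    ((\sum_i \sum_a gi i a *: row a (K i)) *m J^T *m gi) 0 j.
  rewrite -[RHS](congr1 (fun A : 'rV_n => A 0 j) (mulmxA _ _ _)).
  rewrite mulmx_suml summxE; apply: eq_bigr => i _.
  rewrite mulmxA -[_ *m J^T *m gi]mulmxA [LHS]mxE [RHS]mxE.
  apply: eq_bigr => q _; congr (_ * _); rewrite mxE summxE.
  by apply: eq_bigr => a _; rewrite !mxE.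
have E2 : \sum_i (gi *m (J *m (K i)^T) *m gi) i j = \sum_k S k * gi k j.
  under eq_bigr do rewrite mxE.
  rewrite exchange_big; apply: eq_bigr => k _; rewrite -mulr_suml.
  congr (_ * _); apply: eq_bigr => i _; rewrite !mulmxA !mxE.
  by apply: eq_bigr => q _; rewrite [_ q k]mxE [_ q i]mxE KC.
rewrite -E1 -E2.
under eq_bigr do rewrite mxE /T mulmxDr mulmxDl mxE opprD.
by rewrite big_split /= !sumrN subrK.
Qed.

End trace_algebra.

Section local_geometry.
Context {R : realType} {n p : nat}.
Variables (U : set 'rV[R]_n) (u : 'rV[R]_n -> 'rV[R]_p).
Hypothesis U_open : open U.
Hypothesis u_diff : forall z, U z -> differentiable u z.
Hypothesis u_diff2 : forall i z, U z -> differentiable (partial i u) z.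
Hypothesis u_inj : forall z, U z -> injective ('d u z).
Variable y : 'rV[R]_n.
Hypothesis Uy : U y.

Let J := 'J u y.
Let gi := invmx (induced_metric u y).
Let K (i : 'I_n) : 'M[R]_(n, p) := \matrix_(a, k) partial i (partial a u) y 0 k.

Let nearU : \forall z \near y, U z.
Proof. exact: open_nbhs_nbhs. Qed.

Lemma row_jacobian i z : U z -> row i ('J u z) = partial i u z.
Proof.
by move=> Uz; rewrite /partial deriveEjacobian; [rewrite rowE|exact: u_diff].
Qed.

Lemma induced_metricE z : U z -> induced_metric u z = 'J u z *m ('J u z)^T.
Proof.
move=> Uz; apply/matrixP => i j; rewrite !mxE; apply: eq_bigr => k _.
by rewrite -!row_jacobian// !mxE.
Qed.

Lemma jacobian_inj z (v : 'rV_n) : U z -> v *m 'J u z = 0 -> v = 0.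
Proof.
move=> Uz; rewrite /jacobian mul_rV_lin1 => v0.
by apply: (u_inj Uz); rewrite v0 linear0.
Qed.

Lemma induced_metric_unit z : U z -> induced_metric u z \in unitmx.
Proof.
move=> Uz; rewrite induced_metricE//; apply: gram_unit => v.
exact: jacobian_inj.
Qed.

Lemma invmx_metric_sym : gi^T = gi.
Proof. by rewrite /gi induced_metricE// invmx_gram_sym. Qed.

Lemma tangent_partE v : tangent_part u y v = v *m J^T *m gi *m J.
Proof.
by rewrite /tangent_part proj_gramE ?/gi ?induced_metricE// => w; exact: jacobian_inj.
Qed.

Lemma partialC i j : partial i (partial j u) y = partial j (partial i u) y.
Proof.
have uk l k : \forall z \near y,
    is_derive z (delta_mx 0 l) (fun w => u w 0 k : R) (partial l u z 0 k).
  apply: filterS nearU => z Uz.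
  have /is_derive_mxP := is_derive_diff (delta_mx 0 l) (u_diff Uz).
  exact.
have duk l k : differentiable (fun w => partial l u w 0 k : R) y.
  exact: (differentiable_comp (u_diff2 l Uy) (differentiable_coord _ 0 k)).
have E l r k : partial l (partial r u) y 0 k =
    'D_(delta_mx 0 l) (fun w => partial r u w 0 k) y.
  by rewrite [in LHS]/partial derive_mx ?mxE//; exact/diff_derivable/u_diff2.
apply/rowP => k.
have S := mixed_deriveC (uk j k) (uk i k) (duk j k) (duk i k).
exact: etrans (E i j k) (etrans S (esym (E j i k))).
Qed.

Lemma hessian_rows_sym a b : row a (K b) = row b (K a).
Proof.
apply/rowP => k; rewrite [LHS]mxE [RHS]mxE [LHS]mxE [RHS]mxE.
by have /rowP := partialC b a; exact.
Qed.

Lemma is_derive_jacobian i : is_derive y (delta_mx 0 i) (jacobian u) (K i).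
Proof.
apply/is_derive_mxP => a k; rewrite mxE.
have /is_derive_mxP/(_ 0 k) :=
  is_derive_diff (delta_mx 0 i) (u_diff2 a Uy).
apply: near_eq_is_derive.
by apply: filterS nearU => z Uz; rewrite -row_jacobian// mxE.
Qed.

Lemma is_derive_induced_metric i :
  is_derive y (delta_mx 0 i) (induced_metric u) (K i *m J^T + J *m (K i)^T).
Proof.
have Jd := is_derive_jacobian i.
apply: near_eq_is_derive (is_derive_mulmx Jd (is_derive_trmx Jd)).
by apply: filterS nearU => z Uz; rewrite induced_metricE.
Qed.

Lemma is_derive_inverse_metric i :
  is_derive y (delta_mx 0 i) (fun z => invmx (induced_metric u z))
    (- (gi *m (K i *m J^T + J *m (K i)^T) *m gi)).
Proof.
apply: is_derive_invmx (is_derive_induced_metric i).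
by apply: filterS nearU => z Uz; exact: induced_metric_unit.
Qed.

(** Its normal part is the mean curvature vector ([mean_curvatureE]). *)
Definition hessian_trace : 'rV[R]_p :=
  \sum_i \sum_j gi i j *: partial i (partial j u) y.

Lemma partial_gradient h i :
  (forall j, derivable (partial j h) y (delta_mx 0 i)) ->
  partial i (fun z => gradient (induced_metric u) h z 0 i) y =
  \sum_j ((- (gi *m (K i *m J^T + J *m (K i)^T) *m gi)) i j * partial j h y
          + gi i j * partial i (partial j h) y).
Proof.
move=> hd; rewrite /gradient; under eq_fun do rewrite mxE.
apply: derive_val; apply: is_derive_bigsum => j.
have /is_derive_mxP/(_ i j) dg := is_derive_inverse_metric i.
exact: is_derive_mul dg (derivableP (hd j)).
Qed.

Lemma sum_christoffel k :
  \sum_i christoffel (induced_metric u) i i k y =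
  \tr (gi *m (J *m (K k)^T)).
Proof.
have C := @christoffel_trace _ _ _ J gi K invmx_metric_sym k.
apply: etrans C.
have dg l a b : partial l (fun z => induced_metric u z a b) y =
    (K l *m J^T + J *m (K l)^T) a b.
  have /is_derive_mxP/(_ a b) dg := is_derive_induced_metric l.
  exact: derive_val.
apply: eq_bigr => i _; congr (_ * _); apply: eq_bigr => l _.
by congr (_ * _); congr (_ + _ - _); exact: dg.
Qed.

(** The usual formula [g^ij (d_ij h - <u_ij, u_k> g^kl d_l h)]: the Christoffel
    symbols of an induced metric are the tangential components of the second
    derivatives of [u]. *)
Lemma laplacianE h :
  (forall i j, derivable (partial j h) y (delta_mx 0 i)) ->
  laplacian (induced_metric u) h y =
  \sum_i \sum_j gi i j * partial i (partial j h) y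
  - \sum_j (hessian_trace *m J^T *m gi) 0 j * partial j h y.
Proof.
move=> hd; rewrite /laplacian /divergence big_split /=.
under eq_bigr => i _ do rewrite (partial_gradient (hd i)) big_split /=.
rewrite big_split /= addrAC addrC; congr (_ + _).
rewrite [X in X + _]exchange_big [X in _ + X]exchange_big /=.
under [X in _ + X]eq_bigr => k _.
  rewrite -mulr_suml sum_christoffel mxE mulr_sumr.
  under eq_bigr => j _ do rewrite mulrA.
  over.
rewrite [X in _ + X]exchange_big -big_split -sumrN; apply: eq_bigr => j _ /=.
rewrite -!mulr_suml -mulrDl (@laplacian_drift _ _ _ J gi K hessian_rows_sym j).
rewrite mulNr; congr (- (_ * _)); congr ((_ *m _ *m _) _ _).
rewrite /hessian_trace; apply: eq_bigr => i _; apply: eq_bigr => a _.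
by congr (_ *: _); rewrite rowK.
Qed.

(** The drift only shifts the vector whose tangential part is the first-order
    coefficient of the Laplacian, from [hessian_trace] to
    [hessian_trace + u / 2]. *)
Lemma drift_laplacianE h : differentiable h y ->
  (forall i j, derivable (partial j h) y (delta_mx 0 i)) ->
  drift_laplacian u h y =
  \sum_i \sum_j gi i j * partial i (partial j h) y
  - \sum_j ((hessian_trace + 2^-1 *: u y) *m J^T *m gi) 0 j * partial j h y.
Proof.
move=> hd hdd; rewrite /drift_laplacian laplacianE// -addrA -opprD.
congr (_ - _).
have -> : dot ('d u y (gradient (induced_metric u) h y)) (tangent_part u y (u y))
    = \sum_j (u y *m J^T *m gi) 0 j * partial j h y.
  have gradE : gradient (induced_metric u) h y = (\row_j partial j h y) *m gi.
    apply/rowP => i; rewrite !mxE; apply: eq_bigr => j _.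
    by rewrite mxE -/gi -{1}invmx_metric_sym mxE mulrC.
  have -> : 'd u y (gradient (induced_metric u) h y) =
      gradient (induced_metric u) h y *m J by rewrite /J /jacobian mul_rV_lin1.
  rewrite gradE tangent_partE dotE !trmx_mul trmxK invmx_metric_sym !mulmxA.
  rewrite -(mulmxA _ J J^T) -(induced_metricE Uy) -(mulmxA _ gi (induced_metric u y)).
  rewrite mulVmx ?induced_metric_unit// mulmx1.
  have <- : dot (\row_j partial j h y) (u y *m J^T *m gi) =
      \sum_j (u y *m J^T *m gi) 0 j * partial j h y.
    by apply: eq_bigr => j _; rewrite mxE mulrC.
  by rewrite dotE !trmx_mul trmxK invmx_metric_sym !mulmxA.
rewrite mulr_sumr -big_split /=; apply: eq_bigr => j _.
by rewrite mulrA -mulrDl !mulmxDl -!scalemxAl !mxE.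
Qed.

Lemma mean_curvatureE :
  mean_curvature u y = normal_part u y hessian_trace.
Proof.
rewrite /normal_part /hessian_trace /tangent_part mulmx_suml -sumrB.
apply: eq_bigr => i _; rewrite mulmx_suml -sumrB.
apply: eq_bigr => j _.
by rewrite /second_fundamental_form /normal_part /tangent_part scalerBr scalemxAl.
Qed.

Lemma dot_tangent_part v w :
  dot (tangent_part u y v) w = dot v (tangent_part u y w).
Proof.
by rewrite !tangent_partE !dotE !trmx_mul !trmxK invmx_metric_sym !mulmxA.
Qed.

Lemma tangent_part_id v :
  tangent_part u y (tangent_part u y v) = tangent_part u y v.
Proof.
rewrite !tangent_partE -!mulmxA; do 3 congr (_ *m _).
rewrite [J *m _]mulmxA -(induced_metricE Uy) !mulmxA.
by rewrite mulmxV ?mul1mx// induced_metric_unit.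
Qed.

Lemma dot_tangent_part_le v :
  dot (tangent_part u y v) (tangent_part u y v) <= dot v v.
Proof.
set t := tangent_part u y v.
have tt : dot t t = dot v t by rewrite {1}/t dot_tangent_part tangent_part_id.
have := dot_ge0 (v - t).
rewrite -scaleN1r dotDl dotZl ![dot _ (v + _)]dotC !dotDl !dotZl (dotC t v) tt.
lra.
Qed.

Definition sqnorm (z : 'rV[R]_n) : R := dot (u z) (u z).

Lemma partial_sqnorm j z : U z ->
  partial j sqnorm z = 2 * dot (partial j u z) (u z).
Proof.
move=> Uz.
have du := is_derive_diff (delta_mx 0 j) (u_diff Uz).
have [_ E] := is_derive_dot du du; rewrite /partial E.
by rewrite [dot (u z) _]dotC; ring.
Qed.

Lemma is_derive_partial_sqnorm i j :
  is_derive y (delta_mx 0 i) (fun z => 2 * dot (partial j u z) (u z))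
   (2 * (dot (partial i (partial j u) y) (u y) +
      dot (partial j u y) (partial i u y))).
Proof.
have du := is_derive_diff (delta_mx 0 i) (u_diff Uy).
have du2 := is_derive_diff (delta_mx 0 i) (u_diff2 j Uy).
have := is_derive_mul (is_derive_cst (2 : R) y (delta_mx 0 i)) (is_derive_dot du2 du).
by rewrite mul0r add0r.
Qed.

(** The contribution [2 n] is twice the trace of the inverse metric against the
    metric. *)
Lemma trace_hess_sqnorm :
  \sum_i \sum_j gi i j *
    (2 * (dot (partial i (partial j u) y) (u y) +
      dot (partial j u y) (partial i u y)))
  = 2 * dot hessian_trace (u y) + 2 * n%:R.
Proof.
have -> : n%:R = \sum_i \sum_j gi i j * dot (partial j u y) (partial i u y) :> R.
  have <- : \tr (gi *m induced_metric u y) = n%:R.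
    by rewrite mulVmx ?induced_metric_unit// mxtrace1.
  by apply: eq_bigr => i _; rewrite mxE; apply: eq_bigr => j _; rewrite mxE.
rewrite /hessian_trace dot_suml !mulr_sumr -big_split /=.
apply: eq_bigr => i _; rewrite dot_suml !mulr_sumr -big_split /=.
by apply: eq_bigr => j _; rewrite dotZl; ring.
Qed.

(** * Estimates at a maximum of the penalized function *)

Section at_max.
Variables (f : 'rV[R]_n -> R) (e : R).
Hypothesis f_diff : twice_differentiable_on U f.
Hypothesis f_max : \forall z \near y, f z - e * sqnorm z <= f y - e * sqnorm y.

Let dh j z := partial j f z - e * (2 * dot (partial j u z) (u z)).

Let partials_at_max (v : 'rV[R]_n) : (forall j, dh j y = 0) /\
  \sum_i \sum_j v 0 i * v 0 j * partial i (dh j) y <= 0.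
Proof.
have dsq z : U z -> differentiable sqnorm z.
  by move=> Uz; apply: differentiable_dot; exact: u_diff.
apply: (hessian_at_max (h := fun z => f z - e * sqnorm z)) => //.
- apply: filterS nearU => z Uz.
  apply: differentiableB; first by have [] := f_diff Uz.
  by apply: differentiableM => //; exact: dsq.
- move=> j; apply: filterS nearU => z Uz.
  have df := is_derive_diff (delta_mx 0 j) (f_diff Uz).1.
  have ds := is_derive_diff (delta_mx 0 j) (dsq z Uz).
  have [_ E] := is_deriveB df (is_derive_mul (is_derive_cst e z (delta_mx 0 j)) ds).
  rewrite /dh -(partial_sqnorm j Uz); apply: etrans E _.
  by rewrite mul0r add0r.
- move=> j; apply: differentiableB; first by have [_] := f_diff Uy; apply.
  apply: differentiableM => //; apply: differentiableM => //.
  by apply: differentiable_dot; [exact: u_diff2|exact: u_diff].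
Qed.

Lemma partial_at_max j : partial j f y = e * 2 * dot (partial j u y) (u y).
Proof.
have [/(_ j)/eqP + _] := partials_at_max 0.
by rewrite /dh subr_eq0 mulrA => /eqP.
Qed.

Lemma trace_hess_at_max :
  \sum_i \sum_j gi i j * partial i (partial j f) y <=
  e * (2 * dot hessian_trace (u y) + 2 * n%:R).
Proof.
rewrite -trace_hess_sqnorm -subr_le0 mulr_sumr -sumrB.
have dhE i j : partial i (dh j) y = partial i (partial j f) y -
   e * (2 * (dot (partial i (partial j u) y) (u y) +
      dot (partial j u y) (partial i u y))).
  have df := is_derive_diff (delta_mx 0 i) ((f_diff Uy).2 j).
  have dc := is_derive_cst e y (delta_mx 0 i).
  have [_ E] := is_deriveB df (is_derive_mul dc (is_derive_partial_sqnorm i j)).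
  by apply: etrans E _; rewrite mul0r add0r.
(* [gi = B B^T] with [B = gi J], because [gi J J^T gi = gi]. *)
pose B := gi *m J.
have giE i j : gi i j = \sum_k B i k * B j k.
  have -> : gi i j = (B *m B^T) i j.
    rewrite /B trmx_mul mulmxA -(mulmxA gi) -(induced_metricE Uy).
    by rewrite mulVmx ?induced_metric_unit// mul1mx invmx_metric_sym.
  by rewrite mxE; apply: eq_bigr => k _; rewrite [B^T _ _]mxE.
have -> : \sum_i (\sum_j gi i j * partial i (partial j f) y -
    e * \sum_j gi i j *
    (2 * (dot (partial i (partial j u) y) (u y) +
      dot (partial j u y) (partial i u y))))
  = \sum_k \sum_i \sum_j B i k * B j k * partial i (dh j) y.
  rewrite exchange_big /=; apply: eq_bigr => i _; rewrite exchange_big /=.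
  rewrite mulr_sumr -sumrB; apply: eq_bigr => j _.
  by rewrite -mulr_suml -giE dhE; ring.
apply: sumr_le0 => k _; have [_] := partials_at_max (\row_i B i k).
rewrite (eq_bigr (fun i => \sum_j B i k * B j k * partial i (dh j) y))// => i _.
by apply: eq_bigr => j _; rewrite !mxE.
Qed.

(** The gradient of [f] is mapped by the differential of [u] to [2 e] times the
    tangential part of [u], which is no longer than [u]. *)
Lemma metric_norm_gradient_at_max : 0 <= e ->
  metric_norm (induced_metric u y) (gradient (induced_metric u) f y) <=
  2 * e * enorm (u y).
Proof.
move=> e0; rewrite /metric_norm /enorm.
set X := gradient _ _ _.
have XE : X = (e * 2) *: (u y *m J^T *m gi).
  apply/rowP => i; rewrite !mxE mulr_sumr; apply: eq_bigr => j _.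
  rewrite partial_at_max -/gi -{1}invmx_metric_sym [_^T _ _]mxE mulrC -!mulrA.
  congr (_ * (_ * (_ * _))); rewrite mxE /dot; apply: eq_bigr => k _.
  by rewrite -row_jacobian// !mxE mulrC.
have -> : \sum_i \sum_j induced_metric u y i j * X 0 i * X 0 j =
    (e * 2) ^+ 2 * dot (tangent_part u y (u y)) (tangent_part u y (u y)).
  have -> : \sum_i \sum_j induced_metric u y i j * X 0 i * X 0 j =
      (X *m induced_metric u y *m X^T) 0 0.
    rewrite mxE exchange_big; apply: eq_bigr => j _; rewrite !mxE mulr_suml.
    by apply: eq_bigr => i _; rewrite [X 0 i * _]mulrC.
  rewrite (induced_metricE Uy) mulmxA -mulmxA -trmx_mul -dotE.
  have -> : X *m 'J u y = (e * 2) *: tangent_part u y (u y).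
    by rewrite XE -scalemxAl tangent_partE.
  by rewrite dotZl dotC dotZl mulrA.
have e2 : 0 <= e * 2 by rewrite mulr_ge0.
rewrite sqrtrM ?sqr_ge0// sqrtr_sqr (ger0_norm e2) [2 * e]mulrC ler_wpM2l//.
exact/ler_wsqrtr/dot_tangent_part_le.
Qed.

(** By the shrinker equation [hessian_trace + u / 2] is tangent, so its product
    with the tangential part of [u] is its product with [u]; the terms
    containing [hessian_trace] then cancel. *)
Lemma drift_laplacian_at_max :
  mean_curvature u y = - 2^-1 *: normal_part u y (u y) ->
  drift_laplacian u f y <= e * (2 * n%:R - dot (u y) (u y)).
Proof.
move=> Hu; set Z := hessian_trace + 2^-1 *: u y.
have TZ : tangent_part u y Z = Z.
  apply/esym/eqP; rewrite -subr_eq0.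
  have -> : Z - tangent_part u y Z =
      mean_curvature u y + 2^-1 *: normal_part u y (u y).
    rewrite mean_curvatureE /normal_part /Z /tangent_part mulmxDl -scalemxAl.
    by rewrite scalerBr opprD addrACA.
  by rewrite Hu scaleNr addNr.
rewrite drift_laplacianE; first last.
- by move=> i j; apply: diff_derivable; exact: (f_diff Uy).2.
- exact: (f_diff Uy).1.
rewrite -/Z.
have -> : \sum_j (Z *m J^T *m gi) 0 j * partial j f y = e * 2 * dot Z (u y).
  rewrite -{2}TZ tangent_partE dotE -(mulmxA (Z *m J^T *m gi)) [in RHS]mxE mulr_sumr.
  apply: eq_bigr => j _; rewrite partial_at_max mulrCA; congr (_ * (_ * _)).
  rewrite mxE; apply: eq_bigr => k _.
  by rewrite -row_jacobian// !mxE.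
rewrite lerBlDr (le_trans trace_hess_at_max)// /Z dotDl dotZl.
by rewrite le_eqVlt; apply/orP; left; apply/eqP; field.
Qed.

End at_max.
End local_geometry.

(** * Passing to charts *)

Section charts.
Context {R : realType} {n : nat} (M : manifold R n).

Lemma chart_atP (x : M) : atlas M (chart_at x) /\ chart_dom (chart_at x) x.
Proof. by rewrite /chart_at; case: (cid2 _) => c /= ac cx. Qed.

Lemma coord_at_img (x : M) : chart_img (chart_at x) (coord_at x).
Proof. by exists x => //; have [] := chart_atP x. Qed.

Lemma local_expr_coord_at T (h : M -> T) (x : M) :
  local_expr h x (coord_at x) = h x.
Proof. by rewrite /local_expr /= chartK//; have [] := chart_atP x. Qed.

Lemma manifold_continuous (h : M -> R) :
  (forall c, atlas M c -> forall y, chart_img c y ->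
    differentiable (h \o chart_inv c) y) -> continuous h.
Proof.
move=> hc x; have [ac cx] := chart_atP x.
set c := chart_at x in ac cx.
have nx : \forall z \near x, (h \o chart_inv c) (chart_map c z) = h z.
  have : nbhs x (chart_dom c).
    by apply: open_nbhs_nbhs; split => //; exact: chart_dom_open.
  by apply: filterS => z cz /=; rewrite chartK.
apply: cvg_trans (near_eq_cvg nx) _.
rewrite -[h x](nbhs_singleton nx).
apply: (@continuous_comp _ _ _ (chart_map c) (h \o chart_inv c)).
  exact: chart_map_continuous.
by apply: differentiable_continuous; apply: hc => //; exists x.
Qed.

End charts.

(** * Growth and existence of maxima *)

Section growth.
Context {R : realType}.
Implicit Types (s a C e eta t : R).

(** Beyond the threshold [S] where [S `^ (a - 1) = eta], [s `^ a] is at most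
    [eta * s]; before it, [s `^ a] is at most [S `^ a]. *)
Lemma powR_sublinear a eta : 0 <= a -> a < 1 -> 0 < eta ->
  exists2 k, 0 <= k & forall s, 0 <= s -> s `^ a <= eta * s + k.
Proof.
move=> a0 a1 eta0.
pose S := eta `^ (- (1 - a)^-1).
have S0 : 0 < S by exact: powR_gt0.
exists (S `^ a); first exact: powR_ge0.
move=> s s0; have [sS|Ss] := leP s S.
  rewrite ler_wpDl ?mulr_ge0 ?(ltW eta0)//.
  by rewrite ge0_ler_powR// nnegrE ltW.
have sp : 0 < s by rewrite (lt_trans S0).
rewrite ler_wpDr ?powR_ge0//.
have a1' : 0 < 1 - a by rewrite subr_gt0.
have SE : S `^ (1 - a) = eta^-1.
  by rewrite /S -powRrM mulNr mulVf ?gt_eqF// powR_inv1// ltW.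
have : S `^ (1 - a) <= s `^ (1 - a).
  by rewrite ge0_ler_powR// ?nnegrE ltW.
rewrite SE => H.
have -> : s `^ a = s / s `^ (1 - a).
  rewrite -{2}[s]powRr1// -powRB; last by apply/implyP => _; rewrite gt_eqF.
  by congr (_ `^ _); ring.
rewrite [eta * s]mulrC ler_pM2l// -[eta]invrK lef_pV2// posrE ?powR_gt0//.
by rewrite invr_gt0.
Qed.

Lemma le_quadratic t a : 0 <= a -> 0 <= t -> t ^+ 2 <= a ^+ 2 + a * t ->
  t <= 2 * a.
Proof. by move=> a0 t0 H; rewrite leNgt; apply/negP => at2; nra. Qed.

End growth.

Section maxima.
Context {R : realType}.

Lemma norm_le_enorm n (v : 'rV[R]_n) : `|v| <= enorm v.
Proof.
rewrite /Num.Def.normr /= mx_normrE; apply: bigmax_le => [|[i j] _ /=].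
  exact: sqrtr_ge0.
rewrite -sqrtr_sqr ler_wsqrtr// /dot (bigD1 j)//= -expr2 (ord1 i) lerDl.
by apply: sumr_ge0 => k _; rewrite -expr2 sqr_ge0.
Qed.

Lemma compact_norm_ball n (r : R) : compact [set v : 'rV[R]_n | `|v| <= r].
Proof.
apply: bounded_closed_compact.
  exists r; split; first exact: num_real.
  by move=> s rs v /= vr; rewrite (le_trans vr)// ltW.
apply: (closed_comp (f := fun v : 'rV[R]_n => `|v|)) (@closed_le R r).
by move=> v _; exact: norm_continuous.
Qed.

(** The maximum over the compact preimage of a ball that contains [F x0] is
    global, since [h] is below [h x0] off that preimage. *)
Lemma proper_max (X : topologicalType) p (F : X -> 'rV[R]_p) (h : X -> R)
    (x0 : X) (r : R) : proper_map F -> continuous h ->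
  (forall x, r < enorm (F x) -> h x < h x0) ->
  exists x, forall z, h z <= h x.
Proof.
move=> Fp hc hr.
pose s := Num.max r (enorm (F x0)).
pose A := F @^-1` [set v | `|v| <= s].
have Ax0 : A x0 by rewrite /A /= (le_trans (norm_le_enorm _))// le_max lexx orbT.
have [||c _ cmax] := @compact_EVT_max _ _ h A _ (Fp _ (@compact_norm_ball p s)).
- by exists x0.
- exact: continuous_subspaceT.
exists c => z; have [zA|zA] := leP `|F z| s; first by apply: cmax; rewrite inE.
rewrite (le_trans (ltW (hr z _)) (cmax _ _)) ?inE//.
by rewrite (lt_le_trans _ (norm_le_enorm _))// (le_lt_trans _ zA)// le_max lexx.
Qed.

Lemma penalized_max (X : topologicalType) p (F : X -> 'rV[R]_p) (f : X -> R)
    (x0 : X) (C alpha e : R) :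
  proper_map F -> continuous (fun x => f x - e * dot (F x) (F x)) ->
  0 < C -> 0 <= alpha -> alpha < 1 -> 0 < e ->
  (forall x, f x <= C * (1 + enorm (F x) `^ alpha)) ->
  exists x, forall z, f z - e * dot (F z) (F z) <= f x - e * dot (F x) (F x).
Proof.
move=> Fp hc C0 a0 a1 e0 fC.
have [k k0 Hk] := powR_sublinear a0 a1 ltr01.
set h := fun x => _ in hc *.
pose B := C * (1 + k) + `|h x0|.
have B0 : 0 <= B.
  by rewrite addr_ge0// mulr_ge0 ?(ltW C0)// addr_ge0.
(* For [s] beyond this radius, [s >= 1] and [e s^2 > (C + B) s >= C s + B]. *)
apply: (proper_max (x0 := x0) (r := 1 + (C + B) / e)) Fp hc _ => x.
set s := enorm (F x) => sr.
have CB : 0 <= (C + B) / e by rewrite divr_ge0 ?(ltW e0)// addr_ge0// ltW.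
have s1 : 1 < s by rewrite (le_lt_trans _ sr)// lerDl.
have s0 : 0 < s by rewrite (lt_trans ltr01).
have es : C + B < e * s.
  have : (C + B) / e < s by rewrite (le_lt_trans _ sr)// lerDr.
  by rewrite ltr_pdivrMr// mulrC.
have fs : f x <= C * (1 + (1 * s + k)).
  by rewrite (le_trans (fC x))// ler_pM2l// lerD2l Hk// ltW.
have ss : dot (F x) (F x) = s ^+ 2 by rewrite sqr_sqrtr// dot_ge0.
have : h x <= C * (1 + (1 * s + k)) - e * s ^+ 2 by rewrite /h ss lerD2r.
move=> /le_lt_trans; apply.
have h0 : - `|h x0| <= h x0 by rewrite lerNl -normrN ler_norm.
apply: (lt_le_trans _ h0).
have e1 : (C + B) * s < e * s ^+ 2 by rewrite expr2 mulrA ltr_pM2r.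
have e2 : B <= B * s by rewrite ler_peMr// ltW.
by rewrite /B in e1 e2 *; lra.
Qed.

End maxima.

(** * Estimates on the manifold *)

Section shrinker.
Context {R : realType} {n m : nat} (M : manifold R n).
Variables (F : M -> 'rV[R]_(n + m)) (f : M -> R).
Hypothesis F_shrinker : self_shrinker F.
Hypothesis f_diff : twice_differentiable f.

Lemma continuous_penalized (e : R) :
  continuous (fun x => f x - e * dot (F x) (F x)).
Proof.
apply: manifold_continuous => c ac y cy.
have [Fs _] := F_shrinker.1 _ ac.
have Fd : differentiable (F \o chart_inv c) y by exact: (Fs 1%N).1.
have fd : differentiable (f \o chart_inv c) y by exact: (f_diff ac cy).1.
apply: (differentiableB fd); apply: differentiableM => //.
exact: (differentiable_dot Fd Fd).
Qed.

Lemma max_estimates (e : R) (x : M) : 0 <= e ->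
  (forall z, f z - e * dot (F z) (F z) <= f x - e * dot (F x) (F x)) ->
  norm_grad F f x <= 2 * e * enorm (F x) /\
  calL F f x <= e * (2 * n%:R - dot (F x) (F x)).
Proof.
move=> e0 xmax; have [ac cx] := chart_atP x.
have Ux := coord_at_img x.
have Uo : open (chart_img (chart_at x)) by exact: chart_img_open.
have [Fs Fi] := F_shrinker.1 _ ac.
have d1 z : chart_img (chart_at x) z -> differentiable (local_expr F x) z.
  by move=> zU; exact: (Fs 1%N).1.
have d2 i z : chart_img (chart_at x) z ->
    differentiable (partial i (local_expr F x)) z.
  by move=> zU; exact: ((Fs 2%N).2 i).1.
have lmax : \forall z \near coord_at x,
    local_expr f x z - e * sqnorm (local_expr F x) z <=
    local_expr f x (coord_at x) - e * sqnorm (local_expr F x) (coord_at x).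
  by near=> z; rewrite /sqnorm !local_expr_coord_at; exact: xmax.
have := F_shrinker.2 x; rewrite -{1}(local_expr_coord_at F x) => Hx.
rewrite -(local_expr_coord_at F x); split.
  exact: (metric_norm_gradient_at_max Uo d1 d2 Fi Ux (f_diff ac) lmax e0).
exact: (drift_laplacian_at_max Uo d1 d2 Fi Ux (f_diff ac) lmax Hx).
Unshelve. all: by end_near. Qed.

End shrinker.

(** * Letting the penalization vanish *)

Section sequences.
Context {R : realType}.

(** With [t = e * s], the hypothesis times [e] and [powR_sublinear] give
    [t ^+ 2 <= e * B + a * t], where [a] is as small as desired and [B] does not
    depend on [e]; once [e * B <= a ^+ 2] this forces [t <= 2 * a]. *)
Lemma scaled_norm_small (C alpha D eta : R) :
  0 < C -> 0 <= alpha -> alpha < 1 -> 0 <= D -> 0 < eta ->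
  exists2 d, 0 < d & forall e s, 0 < e -> e < d -> 0 <= s ->
    e * s ^+ 2 <= C * (1 + s `^ alpha) + D -> 2 * (e * s) <= eta.
Proof.
move=> C0 a0 a1 D0 eta0; pose a := eta / 4.
have a_gt0 : 0 < a by rewrite divr_gt0.
have aC : 0 < a / C by rewrite divr_gt0.
have [k k0 Hk] := powR_sublinear a0 a1 aC.
pose B := C * (1 + k) + D.
have B0 : 0 < B by rewrite ltr_wpDr// mulr_gt0// ltr_wpDr.
exists (a ^+ 2 / B); first by rewrite divr_gt0// exprn_gt0.
move=> e s e0; rewrite ltr_pdivlMr// => eB s0 es.
have es' : e * s ^+ 2 <= B + a * s.
  rewrite (le_trans es)//.
  have -> : B + a * s = C * (1 + (a / C * s + k)) + D.
    by rewrite /B; field; rewrite gt_eqF.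
  by rewrite lerD2r ler_pM2l// lerD2l Hk.
suff : e * s <= 2 * a by rewrite /a; lra.
apply: le_quadratic; [exact: ltW|by rewrite mulr_ge0// ltW|].
have -> : (e * s) ^+ 2 = e * (e * s ^+ 2) by ring.
rewrite (le_trans (ler_wpM2l (ltW e0) es'))//.
by rewrite mulrDr mulrCA lerD2r ltW.
Qed.

(** The value at a maximum of [f - e_k q] is at least [f y - e_k q y], which
    tends to [f y] for each fixed [y]. *)
Lemma penalized_cvg_sup (T : Type) (f q : T -> R) (e : nat -> R) (x_ : nat -> T)
    (y0 : T) :
  (forall y, 0 <= q y) -> (forall k, 0 <= e k) -> e @ \oo --> 0 ->
  (forall k z, f z - e k * q z <= f (x_ k) - e k * q (x_ k)) ->
  (f (x_ i))%:E @[i --> \oo] --> ereal_sup [set (f x)%:E | x in [set: T]].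
Proof.
move=> q0 e0 ecvg xmax; set S := ereal_sup _.
have fS y : ((f y)%:E <= S)%E by apply: ereal_sup_ubound; exists y.
have low b : (b%:E < S)%E -> \forall k \near \oo, b < f (x_ k).
  move=> /ereal_sup_gt[_ [y _ <-]]; rewrite lte_fin -subr_gt0 => by0.
  have : (fun k => e k * q y) @ \oo --> 0.
    by rewrite -(mul0r (q y)); apply: cvgM => //; exact: cvg_cst.
  move=> /cvgr_lt /(_ _ by0); apply: filterS => k eq.
  have := xmax k y; have := mulr_ge0 (e0 k) (q0 (x_ k)).
  by lra.
have := fS y0; case E : S => [r| |] // _.
- apply: cvg_EFin; first exact: nearW.
  apply/cvgrPdist_lt => d d0 /=.
  have : \forall k \near \oo, r - d < f (x_ k).
    by apply: low; rewrite E lte_fin ltrBlDr ltrDl.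
  apply: filterS => k rd.
  have : f (x_ k) <= r by rewrite -lee_fin -E fS.
  by rewrite -subr_ge0 => /ger0_norm ->; rewrite ltrBlDr -ltrBlDl.
- apply/cvgeyPgt => A; under eq_near do rewrite lte_fin.
  by apply: low; rewrite E ltry.
Qed.

Lemma limn_esup_le0 (u e : nat -> R) : (forall k, u k <= e k) -> e @ \oo --> 0 ->
  (limn_esup (fun k => (u k)%:E) <= 0)%E.
Proof.
move=> ue ecvg; apply/lee_addgt0Pr => d d0; rewrite add0e.
have /cvgr_le/(_ _ d0) ed := ecvg.
apply: (@le_trans _ _ (ereal_sup ((fun k => (u k)%:E) @` [set k | e k <= d]))).
  by apply: ereal_inf_lbound; exists [set k | e k <= d].
by apply: ge_ereal_sup => _ [k /= ekd <-]; rewrite lee_fin (le_trans (ue k)).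
Qed.

End sequences.

Theorem theorem1p4 (R : realType) (n m : nat) (M : manifold R n)
    (M_neq0 : [set: M] !=set0)
    (F : M -> 'rV[R]_(n + m)) (F_shrinker : self_shrinker F)
    (F_proper : proper_map F)
    (f : M -> R) (f_diff : twice_differentiable f)
    (C alpha : R) (C_gt0 : 0 < C) (alpha_ge0 : 0 <= alpha)
    (alpha_lt1 : alpha < 1)
    (f_growth : forall x : M, f x <= C * (1 + enorm (F x) `^ alpha)) :
  exists x_ : nat -> M,
    [/\ (f (x_ i))%:E @[i --> \oo]
          --> ereal_sup [set (f x)%:E | x in [set: M]],
        norm_grad F f (x_ i) @[i --> \oo] --> (0 : R) &
        (limn_esup (fun i => (calL F f (x_ i))%:E) <= 0)%E].
Proof.
have [x0 _] := M_neq0.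
pose e : nat -> R := @harmonic R.
have e0 k : 0 < e k by rewrite invr_gt0.
have ecvg : e @ \oo --> 0 := cvg_harmonic.
have /(@choice nat M)[x_ xmax] : forall k, exists x, forall z,
    f z - e k * dot (F z) (F z) <= f x - e k * dot (F x) (F x).
  move=> k.
  apply: (penalized_max x0 F_proper _ C_gt0 alpha_ge0 alpha_lt1 (e0 k)) => //.
  exact: continuous_penalized.
have est k := max_estimates F_shrinker f_diff (ltW (e0 k)) (xmax k).
exists x_; split.
- apply: (@penalized_cvg_sup _ _ f (fun x => dot (F x) (F x)) e x_ x0) => //.
  + by move=> y; exact: dot_ge0.
  + by move=> k; exact: ltW.
- apply/cvgr0Pnorm_le => eta eta0.
  pose D := `|f x0| + dot (F x0) (F x0).
  have D0 : 0 <= D by rewrite addr_ge0// dot_ge0.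
  have [d d0 small] := scaled_norm_small C_gt0 alpha_ge0 alpha_lt1 D0 eta0.
  have /cvgr_lt/(_ _ d0) := ecvg; apply: filterS => k ekd.
  rewrite ger0_norm; last exact: sqrtr_ge0.
  apply: le_trans (est k).1 _; rewrite -mulrA; apply: small => //.
    exact: sqrtr_ge0.
  rewrite sqr_sqrtr ?dot_ge0//.
  have ek1 : e k <= 1 by rewrite invf_le1// ler1n.
  have := xmax k x0; have := f_growth (x_ k).
  have := ler_norm (- f x0); rewrite normrN.
  have := ler_wpM2r (dot_ge0 (F x0)) ek1.
  by rewrite /D mul1r; lra.
- apply: (@limn_esup_le0 _ _ (fun k => e k * (2 * n%:R))).
    move=> k; apply: le_trans (est k).2 _.
    by rewrite ler_pM2l// gerBl dot_ge0.
  by rewrite -(mul0r (2 * n%:R)); apply: cvgM => //; exact: cvg_cst.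
Qed.
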